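(* Let $n\ge 5$ and let $K_n$ be the complete graph on $n$ vertices. There exist uncountably many evasive walks $S$ on $K_n$ such that for every vertex $v$ of $K_n$, the set $S^{-1}(v)=\{i\in\mathbb{N}: S(i)=v\}$ has upper density at least $1/n$.
   Context: The upper density of a set $X\subseteq\mathbb{N}$ is $\limsup_{m\to\infty}|X\cap\{1,\ldots,m\}|/m$. A walk on a graph $G$ is an infinite sequence $R(1),R(2),\ldots$ of vertices with $R(i)$ adjacent to $R(i+1)$ for all $i$. A random walk on $G$: $R(1)$ uniform among vertices, each $R(i+1)$ uniform among neighbours of $R(i)$. For walks $R,S$, tokens $T_R,T_S$ start at $R(1),S(1)$; a move advances exactly one token one step along its own walk. The pair $(R,S)$ is successful if there is an infinite sequence of moves in which each token is advanced infinitely often and the tokens never occupy the same vertex simultaneously (including initially). A walk $S$ is evasive if for a random walk $R$ on $G$, $(R,S)$ is successful with positive probability. *)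

(* Defs.v *)
From HB Require Import structures.
From mathcomp Require Import all_boot all_order all_algebra.
From mathcomp Require Import all_classical all_reals all_analysis.

Set Implicit Arguments.
Unset Strict Implicit.
Unset Printing Implicit Defensive.

Import Order.TTheory GRing.Theory Num.Theory.

Local Open Scope classical_set_scope.
Local Open Scope ring_scope.

(* Positive integers are {1, 2, ...}; the term m = 0 is irrelevant to the
   limsup (it is 0 / 0 = 0). *)
Definition upper_density (R : realType) (X : set nat) : \bar R :=
  limn_esup (fun m : nat =>
    ((\sum_(1 <= i < m.+1) (i \in X)%:R : R) / m%:R)%:E).

(* A graph is given by its adjacency relation on a finite vertex type.
   Sequences are indexed from 0, so [S i] is the (i+1)-st vertex S(i+1). *)
Definition is_walk (V : finType) (e : rel V) (S : nat -> V) : Prop :=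
  forall i, e (S i) (S i.+1).

(* S^-1(v), as a subset of {1, 2, ...}: hence the shift by one. *)
Definition visit_times (V : finType) (S : nat -> V) (v : V) : set nat :=
  [set i.+1 | i in [set i | S i = v]].

(* [rw_step] says that, conditionally on the trajectory h 0, ..., h i so far,
   the next vertex is uniform among the neighbours of h i; it is written
   multiplicatively so as to make sense for histories of probability 0. *)
Record random_walk (R : realType) (V : finType) (e : rel V)
    (d : measure_display) (Omega : measurableType d) (P : probability Omega R)
    (W : nat -> Omega -> V) : Prop := RandomWalk {
  rw_measurable : forall i v, measurable [set w | W i w = v] ;
  rw_start : forall v, P [set w | W 0%N w = v] = (#|V|%:R^-1)%:E ;
  rw_step : forall (i : nat) (h : nat -> V),
    P [set w | forall j, (j <= i.+1)%N -> W j w = h j] =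
    (P [set w | forall j, (j <= i)%N -> W j w = h j] *
     (if e (h i) (h i.+1) then #|[set v | e (h i) v]%SET|%:R^-1 else 0)%:E)%E
}.

(* A sequence of moves is [move : nat -> bool]: move t = true advances the
   first token, move t = false the second one. *)
Definition steps (move : nat -> bool) (b : bool) (t : nat) : nat :=
  (\sum_(s < t) (move s == b))%N.

Definition successful (V : finType) (W S : nat -> V) : Prop :=
  exists move : nat -> bool,
    (forall b k, exists2 t, (k <= t)%N & move t = b) /\
    (forall t, W (steps move true t) != S (steps move false t)).

(* The law of the random walk is determined by [random_walk], so quantifying
   over all realizations of it is the same as fixing one.  The set of
   successful outcomes is the projection of a Borel set along the choice of
   moves, hence universally measurable but not evidently an element of the
   sigma-algebra; having positive probability (for the completion of P) means
   containing a measurable set of positive probability. *)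
Definition evasive (R : realType) (V : finType) (e : rel V) (S : nat -> V)
    : Prop :=
  forall (d : measure_display) (Omega : measurableType d)
    (P : probability Omega R) (W : nat -> Omega -> V),
  random_walk e P W ->
  exists A : set Omega,
    [/\ measurable A,
        A `<=` [set w | successful (fun i => W i w) S]
      & (0 < P A)%E].

Definition complete_graph (n : nat) : rel 'I_n := fun i j => i != j.

(* Main.v *)
Require Import Defs.
From mathcomp Require Import all_boot all_order all_algebra zify.
From mathcomp Require Import all_classical all_reals all_analysis.

(* Let A_k be the triple of vertices k, k+1, k+2 (modulo n) and c_k = k+3; as
   n >= 5, c_k lies outside both A_{k-1} and A_k.  The walk S spends its k-th
   block inside A_k, first alternating between k and another vertex for at
   least two thirds of the time elapsed so far, which settles the densities,
   and then listing all words of some length l_k over A_k, consecutive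
   repetitions being deleted.  Fix consecutive time windows whose lengths grow
   linearly.  The random walk R misses c_k in the k-th window with
   exponentially small probability, so with positive probability it visits
   every c_k in its window.  For such an R the token of S crosses from one
   block to the next while the other token waits at c_k.  Between the visits
   to c_k and c_{k+1} it can stay in A_k: if R moves from v to w it should be
   at a vertex of A_k other than v and w, and the resulting word is listed in
   the k-th block. *)

Set Implicit Arguments.
Unset Strict Implicit.
Unset Printing Implicit Defensive.

Import Order.TTheory GRing.Theory Num.Theory.
Import numFieldNormedType.Exports.

(** * Increasing sequences, universal words and schedules of moves *)

Lemma increasing_phase (p : nat -> nat) :
    p 0 = 0 -> (forall k, p k < p k.+1) ->
  exists ph : nat -> nat, forall t, p (ph t) <= t < p (ph t).+1.
Proof.
move=> p0 p_inc; suff ex_ph t : exists k, p k <= t < p k.+1.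
  by have [ph phP] := choice ex_ph; exists ph.
have p_ge k : k <= p k by elim: k => // k IH; exact: leq_ltn_trans IH (p_inc k).
have ex : exists k, t < p k.+1 by exists t; exact: leq_trans (p_ge _).
case: (ex_minnP ex) => -[t1 _|k ltk mink]; first by exists 0; rewrite p0 t1.
by exists k.+1; rewrite ltk andbT leqNgt; apply/negP => /mink; rewrite ltnn.
Qed.

Lemma increasing_homo (p : nat -> nat) :
  (forall k, p k < p k.+1) -> {homo p : k l / k <= l}.
Proof.
by move=> p_inc; apply: homo_leq => // [x y z|k]; [exact: leq_trans|exact: ltnW].
Qed.

Lemma phase_unique (p : nat -> nat) k l t :
    (forall k, p k < p k.+1) ->
  p k <= t < p k.+1 -> p l <= t < p l.+1 -> k = l.
Proof.
move=> p_inc /andP[kt tk] /andP[lt tl]; have mono := increasing_homo p_inc.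
by case: (ltngtP k l) => // [/mono|/mono] h; lia.
Qed.

Lemma universal_word (T : finType) (x0 : T) (l : nat) :
  exists N (u : nat -> T), forall y : nat -> T,
    exists2 o, o + l <= N & forall i, i < l -> u (o + i) = y i.
Proof.
pose w := enum {ffun 'I_l -> T}.
(* All words of length [l] are concatenated, so [y] starts at a multiple of [l]; [insub] fails only
   when [l = 0]. *)
exists (size w * l), (fun t => oapp (nth [ffun=> x0] w (t %/ l)) x0 (insub (t %% l))).
move=> y; pose f := [ffun i : 'I_l => y i].
have fw : index f w < size w by rewrite index_mem mem_enum.
exists (index f w * l) => [|i il].
  by rewrite addnC -mulSn leq_mul2r fw orbT.
rewrite modnMDl modn_small // divnMDl ?(leq_trans _ il) //.
by rewrite divn_small // addn0 nth_index ?mem_enum // insubT /= ffunE.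
Qed.

(* [G i.+1] is the position of the second token when the first one leaves [W i]. *)
Lemma staircase_successful (V : finType) (W S : nat -> V) (G : nat -> nat) :
    G 0 = 0 -> {homo G : i j / i <= j} -> (forall N, exists i, N <= G i) ->
    (forall i j, G i <= j <= G i.+1 -> S j != W i) ->
  successful W S.
Proof.
move=> G0 Gmono Gunb GS.
(* Greedy schedule: the second token moves until it is at [G i.+1], then the first one leaves
   [W i]. *)
pose stp (x : nat * nat) := if x.2 < G x.1.+1 then (x.1, x.2.+1) else (x.1.+1, x.2).
pose st t := iter t stp (0, 0).
pose mv t := ~~ ((st t).2 < G (st t).1.+1).
have stS t : st t.+1 = stp (st t) by [].
have inv t : G (st t).1 <= (st t).2 <= G (st t).1.+1.
  elim: t => [|t IH]; first by rewrite /= G0.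
  rewrite stS /stp; case: ifP => /= h; first by lia.
  by have := Gmono (st t).1.+1 (st t).1.+2; lia.
have stE t : (steps mv true t = (st t).1) /\ (steps mv false t = (st t).2).
  elim: t => [|t [IH1 IH2]]; first by rewrite /steps !big_ord0.
  rewrite /steps !big_ord_recr /= -![(\sum_(s < t) _)%N]/(steps mv _ t) IH1 IH2.
  rewrite /stp /mv.
  by case: ifP => _ /=; split; lia.
exists mv; split; last first.
  by move=> t; have [-> ->] := stE t; rewrite eq_sym; exact: GS.
(* If one token stopped for good, the other would advance forever, against [inv]: the second is
   bounded by [G], and [G] is unbounded along the first. *)
move=> b k; apply: contrapT => no.
have mvb t : k <= t -> mv t = ~~ b.
  move=> kt; case: (mv t =P b) => [e|/eqP]; first by case: no; exists t.
  by clear; case: b (mv t) => -[].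
have far m : st (k + m) =
    if b then ((st k).1, (st k).2 + m) else ((st k).1 + m, (st k).2).
  elim: m => [|m IH]; first by rewrite !addn0; clear; case: b => //; case: (st k).
  have := mvb (k + m) (leq_addr _ _); rewrite addnS stS /stp /mv IH.
  by clear; case: b => /=; case: ifP => //= _ _; rewrite addnS.
case: b no mvb far => no mvb far.
  by have := inv (k + (G (st k).1.+1).+1); rewrite far /=; lia.
have [i Gi] := Gunb (st k).2.+1.
have := inv (k + i); rewrite far /=.
by have := Gmono i ((st k).1 + i) (leq_addl _ _); lia.
Qed.

(** * Deletion of consecutive repetitions *)

(** This is the position that the letter [S t] takes once consecutive repetitions are deleted. *)
Definition changes (T : eqType) (S : nat -> T) (t : nat) : nat :=
  \sum_(s < t) (S s != S s.+1).

Lemma changesS (T : eqType) (S : nat -> T) t :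
  changes S t.+1 = changes S t + (S t != S t.+1).
Proof. by rewrite /changes big_ord_recr. Qed.

Lemma changes0 (T : eqType) (S : nat -> T) : changes S 0 = 0.
Proof. by rewrite /changes big_ord0. Qed.

Lemma changes_homo (T : eqType) (S : nat -> T) : {homo changes S : s t / s <= t}.
Proof.
apply: homo_leq => // [x y z|t]; first exact: leq_trans.
by rewrite changesS leq_addr.
Qed.

Lemma changes_leq (T : eqType) (S : nat -> T) t : changes S t <= t.
Proof. by elim: t => [|t IH]; rewrite ?changes0 // changesS; lia. Qed.

(** The count starts at 0 and grows by at most 1, so it skips no value. *)
Lemma changes_hit (T : eqType) (S : nat -> T) m t :
  m <= changes S t -> exists2 s, s <= t & changes S s = m.
Proof.
elim: t => [|t IH].
  by rewrite changes0 leqn0 => /eqP ->; exists 0; rewrite ?changes0.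
rewrite changesS; have [/IH[s st <-] _|lt le] := leqP m (changes S t).
  by exists s => //; exact: leqW.
by exists t.+1 => //; rewrite changesS; lia.
Qed.

Lemma changes_eq (T : eqType) (S : nat -> T) s t :
  changes S s = changes S t -> S s = S t.
Proof.
wlog st : s t / s <= t => [hw e|].
  by case: (leqP s t) => [|/ltnW] st; [apply: hw|symmetry; apply: hw].
rewrite -(subnKC st); elim: (t - s) => [|d IH] e; first by rewrite addn0.
have := changes_homo S (leq_addr d s); have := changesS S (s + d).
rewrite -addnS -e => h1 h2; rewrite IH; last by lia.
by rewrite addnS; apply/eqP; move: h1; rewrite addnS; case: eqP => //= _; lia.
Qed.

Lemma changes_unbounded (T : eqType) (L : nat -> T) :
    (forall N, exists2 s, N <= s & L s != L s.+1) ->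
  forall m, exists t, m <= changes L t.
Proof.
move=> Lvar; elim=> [|m [t mt]]; first by exists 0.
have [s ts Ls] := Lvar t; exists s.+1; rewrite changesS Ls.
by have := changes_homo L ts; lia.
Qed.

Lemma remove_repeats (T : eqType) (L : nat -> T) :
    (forall N, exists2 s, N <= s & L s != L s.+1) ->
  exists S : nat -> T, (forall t, S (changes L t) = L t) /\
    (forall m, S m != S m.+1).
Proof.
move=> Lvar.
have unb := changes_unbounded Lvar.
have hit m : exists t, changes L t = m.
  by have [t /changes_hit[s _ sm]] := unb m; exists s.
have [psi psiK] := choice hit; exists (L \o psi); split=> /= [t|m].
  by apply: changes_eq; rewrite psiK.
(* The least position whose count reaches [m.+1] comes right after a change, so the letters before
   and at it represent [S m] and [S m.+1]. *)
case: (ex_minnP (unb m.+1)) => -[|t]; first by rewrite changes0.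
move=> mt mint; have tm : changes L t <= m.
  by rewrite leqNgt; apply/negP => /mint; rewrite ltnn.
move: mt; rewrite changesS; case: eqVneq => [_|Lt]; first by lia.
move=> mt; have em : changes L t = m by lia.
have em1 : changes L t.+1 = m.+1 by rewrite changesS Lt em addn1.
by rewrite (@changes_eq _ _ _ t) ?psiK // (@changes_eq _ _ (psi m.+1) t.+1) ?psiK.
Qed.

(** As [changes] is monotone and skips no value, it carries a staircase over [L] to one over [S];
    the moves can thus be planned on [L], where repetitions are allowed. *)
Lemma staircase_remove_repeats (V : finType) (W L S : nat -> V) (G : nat -> nat) :
    (forall t, S (changes L t) = L t) ->
    (forall N, exists2 s, N <= s & L s != L s.+1) ->
    G 0 = 0 -> {homo G : i j / i <= j} -> (forall N, exists i, N <= G i) ->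
    (forall i j, G i <= j <= G i.+1 -> L j != W i) ->
  successful W S.
Proof.
move=> SL Lvar G0 Gmono Gunb GL.
apply: (@staircase_successful _ _ _ (changes L \o G)) => /=.
- by rewrite G0 changes0.
- by move=> i j /Gmono /(changes_homo L).
- move=> N; have [t Nt] := changes_unbounded Lvar N.
  by have [i ti] := Gunb t; exists i; rewrite (leq_trans Nt) // changes_homo.
move=> i j /andP[ij /changes_hit[s sG sj]].
have [Gs|/ltnW Gs] := leqP (G i) s.
  by rewrite -sj SL; apply: (GL i); rewrite Gs.
have -> : j = changes L (G i) by have := changes_homo L Gs; lia.
by rewrite SL; apply: (GL i); rewrite leqnn Gmono.
Qed.

(** * The sequence with repetitions and the staircase on it *)

(** There are at least five vertices. Offsets 0 to 2 form the triple of block [k]; offsets 3 and 4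
    are [c_k] and [c_{k+1}]. *)
Lemma inZp_window_inj n k i j : i < 5 -> j < 5 ->
  inZp (k + i) = inZp (k + j) :> 'I_n.+4.+1 -> i = j.
Proof.
move=> i5 j5 /(congr1 val) /= /eqP; rewrite eqn_modDl.
by rewrite !modn_small ?(leq_trans i5) ?(leq_trans j5) // => /eqP.
Qed.

Lemma third_vertex n k (v w : 'I_n.+4.+1) :
  exists a : 'I_3, inZp (k + a) != v /\ inZp (k + a) != w.
Proof.
have neq i j : i < j < 3 -> inZp (k + i) != inZp (k + j) :> 'I_n.+4.+1.
  by move=> ij; apply/eqP => /inZp_window_inj; lia.
case: (boolP [exists a : 'I_3, (inZp (k + a) != v) && (inZp (k + a) != w)]).
  by case/existsP => a /andP[]; exists a.
rewrite negb_exists => /forallP no.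
have := no (@Ordinal 3 0 isT); have := no (@Ordinal 3 1 isT).
have := no (@Ordinal 3 2 isT) => /=; rewrite !negb_and !negbK.
have := neq 0 1 isT; have := neq 0 2 isT; have := neq 1 2 isT.
by move=> n12 n02 n01 /orP[]/eqP e2 /orP[]/eqP e1 /orP[]/eqP e0;
  move: n12 n02 n01; rewrite e0 e1 e2 ?eqxx.
Qed.

(* Block k of [L f] uses the vertices k, k+1, k+2 only. Its first
   [2 * (p k).+1] letters, which are long enough to give k density 1/n,
   alternate between k and k+1 or k+2, as dictated by [f k]; the others contain
   all words of length [l k] over the three vertices. *)
Lemma lazy_sequence n (l : nat -> nat) :
  exists (p : nat -> nat) (L : (nat -> bool) -> nat -> 'I_n.+4.+1),
  [/\ p 0 = 0, forall k, p k + 2 * (p k).+1 <= p k.+1,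
      forall f g k, (forall i, i < k -> f i = g i) ->
        forall j, j <= p k -> L f j = L g j
    & forall f,
      [/\ forall k j, p k <= j < p k.+1 -> exists i : 'I_3, L f j = inZp (k + i),
          forall k j, j < 2 * (p k).+1 ->
            L f (p k + j) = inZp (k + if odd j then (f k).+1 else 0)
        & forall k (y : nat -> 'I_3), exists q,
            [/\ p k <= q, q + l k <= p k.+1
              & forall i, i < l k -> L f (q + i) = inZp (k + y i)]]].
Proof.
have [N ex_u] := choice (fun k => @universal_word 'I_3 ord0 (l k)).
have [u uP] := choice ex_u.
pose p := fix p k := if k is k'.+1 then p k' + 2 * (p k').+1 + N k' else 0.
have pS k : p k.+1 = p k + 2 * (p k).+1 + N k by [].
have p_inc k : p k < p k.+1 by rewrite pS; lia.
have [ph phP] := increasing_phase (erefl : p 0 = 0) p_inc.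
have phE k t : p k <= t < p k.+1 -> ph t = k.
  by move=> kt; apply: phase_unique p_inc (phP t) kt.
pose a (f : nat -> bool) t := let k := ph t in let j := t - p k in
  if j < 2 * (p k).+1 then inord (if odd j then (f k).+1 else 0)
  else u k (j - 2 * (p k).+1).
pose L f t : 'I_n.+4.+1 := inZp (ph t + a f t).
have altL f k j : j < 2 * (p k).+1 ->
    L f (p k + j) = inZp (k + if odd j then (f k).+1 else 0).
  move=> kj; have e : ph (p k + j) = k by apply: phE; rewrite pS; lia.
  by rewrite /L /a e addKn kj inordK //; case: odd; case: f.
exists p, L; split=> // [k|f g k fg j|f]; first by rewrite pS leq_addr.
  (* Position [p k] already lies in block [k], but its letter is [k] whatever [f k] is. *)
  rewrite leq_eqVlt => /predU1P[->|jp]; first by rewrite -(addn0 (p k)) !altL.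
  rewrite /L /a fg // ltnNge; apply/negP => /(increasing_homo p_inc).
  by have := phP j; lia.
split; [|exact: altL|].
- by move=> k j kj; rewrite /L (phE k j kj); exists (a f j).
move=> k y; have [q qN uq] := uP k y.
exists (p k + 2 * (p k).+1 + q); split; first by lia.
  by rewrite pS -addnA leq_add2l.
move=> i il; have e : ph (p k + 2 * (p k).+1 + q + i) = k by apply: phE; rewrite pS; lia.
rewrite /L /a e ifF; last by lia.
by rewrite -uq //; congr (inZp (_ + u k _)); lia.
Qed.

Lemma hitting_staircase n (l p t : nat -> nat) (L W : nat -> 'I_n.+4.+1) :
    p 0 = 0 -> (forall k, p k < p k.+1) ->
    (forall k j, p k <= j < p k.+1 -> exists i : 'I_3, L j = inZp (k + i)) ->
    (forall k (y : nat -> 'I_3), exists o,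
      [/\ p k <= o, o + l k <= p k.+1
        & forall i, i < l k -> L (o + i) = inZp (k + y i)]) ->
    t 0 = 0 -> t 1 = 1 -> (forall k, t k.+2 - t k <= l k) ->
    (forall k, exists i, t k <= i < t k.+1 /\ W i = inZp (k + 3)) ->
  exists G : nat -> nat,
    [/\ G 0 = 0, {homo G : i j / i <= j}, (forall N, exists i, N <= G i)
      & forall i j, G i <= j <= G i.+1 -> L j != W i].
Proof.
move=> p0 p_inc LA Luniv t0 t1 tl Whit.
have [s /all_and2[st sW]] := choice Whit.
(* The first window is [{0}]. *)
have s0 : s 0 = 0 by have := st 0; lia.
have s_inc k : s k < s k.+1 by have := st k; have := st k.+1; lia.
have [ph phP] := increasing_phase s0 s_inc.
have phE k i : s k <= i < s k.+1 -> ph i = k.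
  by move=> ki; apply: phase_unique s_inc (phP i) ki.
have [y yP] := choice (fun ki : nat * nat =>
  third_vertex ki.1 (W (s ki.1 + ki.2)) (W (s ki.1 + ki.2).+1)).
have [q qP] := choice (fun k => Luniv k (fun r => y (k, r))).
(* At step [i] of phase [k] the token is at letter [i - s k] of the word found in block [k], which
   differs from both [W i] and [W i.+1]. *)
pose G i := if i is i'.+1 then q (ph i') + (i' - s (ph i')) else 0.
have GP i k : ph i = k -> [/\ p k <= G i.+1, G i.+1 < p k.+1,
    L (G i.+1) != W i & L (G i.+1) != W i.+1].
  move=> e; have := phP i; rewrite /= e => ki.
  have [qk qkl qL] := qP k.
  have il : i - s k < l k.
    by have := tl k; have := st k; have := st k.+1; lia.
  have [] := yP (k, i - s k); rewrite /= -qL // subnKC; last by lia.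
  by split=> //; lia.
have Gstep i : (G i.+2 = (G i.+1).+1) \/ (ph i.+1 = (ph i).+1 /\ i.+1 = s (ph i.+1)).
  have := phP i; set k := ph i => ki.
  have [ik|ik] := ltnP i.+1 (s k.+1).
    have e : ph i.+1 = k by apply: phE; lia.
    by left; rewrite /= e -/k; lia.
  have ek : i.+1 = s k.+1 by lia.
  have e : ph i.+1 = k.+1 by apply: phE; rewrite ek leqnn s_inc.
  by right; rewrite e.
have Gmono : {homo G : i j / i <= j}.
  apply: homo_leq => // [x z w|[|i]]; [exact: leq_trans| by [] |].
  case: (Gstep i) => [->|[e _]]; first exact: leqnSn.
  by have [_ + _ _] := GP i _ erefl; have [+ _ _ _] := GP i.+1 _ e; lia.
have avoid k j : p k <= j < p k.+1 -> L j != inZp (k + 3) /\ L j != inZp (k.+1 + 3).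
  move=> /LA[i ->]; rewrite addSnnS.
  by split; apply/eqP => /inZp_window_inj; have := ltn_ord i; lia.
exists G; split=> //.
  move=> N; exists (s N).+1; have e : ph (s N) = N by apply: phE; rewrite leqnn s_inc.
  have [le _ _ _] := GP _ _ e; apply: leq_trans le.
  by elim: N {e} => // N; have := p_inc N; lia.
(* Up to [G 1] the first token waits at [c_0], outside the triple of block 0. *)
move=> [|i] j ij.
  have e : ph 0 = 0 by apply: phE; have := s_inc 0; rewrite s0.
  have [_ lt _ _] := GP _ _ e.
  by have := sW 0; rewrite s0 => ->; apply: (proj1 (avoid 0 j _)); lia.
case: (Gstep i) => [e|[e es]].
  have [_ _ _ h1] := GP i _ erefl; have [_ _ h2 _] := GP i.+1 _ erefl.
  have /orP[/eqP->|/eqP->] // : (j == G i.+1) || (j == G i.+2) by lia.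
(* At a change of phase, [W i.+1] is [c_{k+1}] with [k = ph i], outside the triples of both blocks
   [k] and [k.+1]. *)
have [h1 h2 _ _] := GP i _ erefl; have [h3 h4 _ _] := GP i.+1 _ e.
have -> : W i.+1 = inZp ((ph i).+1 + 3) by rewrite es sW e.
have [jp|jp] := ltnP j (p (ph i).+1); first by apply: (proj2 (avoid (ph i) j _)); lia.
by apply: (proj1 (avoid (ph i).+1 j _)); lia.
Qed.

Local Open Scope classical_set_scope.
Local Open Scope ring_scope.

(** * Hitting probabilities of the random walk *)

Lemma measurable_forall_le (d : measure_display) (T : measurableType d)
    (F : nat -> set T) (m : nat) :
  (forall j, measurable (F j)) ->
  measurable [set w | forall j, (j <= m)%N -> F j w].
Proof.
move=> mF; have -> : [set w | forall j, (j <= m)%N -> F j w] =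
    \bigcap_(j in [set j | (j <= m)%N]) F j by [].
exact: bigcap_measurableType.
Qed.

(** Total probability over the finitely many values of [X]. *)
Lemma probability_scale_fibers (R : realType) (d : measure_display)
    (Omega : measurableType d) (P : probability Omega R) (T : finType)
    (X : Omega -> T) (A B : set Omega) (a : R) :
    0 <= a -> measurable A -> measurable B ->
    (forall h, measurable [set w | X w = h]) ->
    (forall h, P (A `&` [set w | X w = h]) = a%:E * P (B `&` [set w | X w = h]))%E ->
  (P A = a%:E * P B)%E.
Proof.
move=> a0 mA mB mX AB.
have split D : measurable D ->
    (P D = \sum_(h \in [set: T]) P (D `&` [set w | X w = h]))%E.
  move=> mD; rewrite -measure_fin_bigcup //.
  - congr (P _); apply/seteqP; split => [w Dw|w [h _ []] //].
    by exists (X w).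
  - exact: finite_finset.
  - by move=> h1 h2 _ _ [w [[_ /= <-] [_ /= <-]]].
  - by move=> h _; apply: measurableI.
rewrite split // (split B) // ge0_mule_fsumr //; apply: eq_fsbigr => h _.
exact: AB.
Qed.

Section walk.
Context (R : realType) (n : nat) (d : measure_display).
Context (Omega : measurableType d) (P : probability Omega R).
Context (W : nat -> Omega -> 'I_n.+2).
Hypothesis rwW : random_walk (@complete_graph n.+2) P W.

(** The conditional probability that a step misses a given neighbour, each vertex having [n.+1] of
    them. *)
Let ratio : R := 1 - n.+1%:R^-1.

Lemma measurable_cylinder (h : nat -> 'I_n.+2) m :
  measurable [set w | forall j, (j <= m)%N -> W j w = h j].
Proof.
by apply: (@measurable_forall_le _ _ (fun j => [set w | W j w = h j])) => j; case: rwW.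
Qed.

Lemma measurable_avoid (c : 'I_n.+2) s m :
  measurable [set w | forall j, (j <= m)%N -> W (s + j)%N w != c].
Proof.
apply: (@measurable_forall_le _ _ (fun j => [set w | W (s + j)%N w != c])) => j.
have -> : [set w | W (s + j)%N w != c] = ~` [set w | W (s + j)%N w = c].
  by apply/seteqP; split=> w /= /eqP.
by apply: measurableC; case: rwW.
Qed.

Lemma cylinder_step_avoid (h : nat -> 'I_n.+2) (c : 'I_n.+2) i : h i != c ->
  (P ([set w | forall j, (j <= i)%N -> W j w = h j] `&` [set w | W i.+1 w != c]) =
   ratio%:E * P [set w | forall j, (j <= i)%N -> W j w = h j])%E.
Proof.
move=> hic; set C := [set w | _].
have mC : measurable C by exact: measurable_cylinder.
have mc : measurable [set w | W i.+1 w = c] by case: rwW.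
(* The history [h] continued by [c]: [rw_step] gives it the complementary factor [n.+1%:R^-1]. *)
pose h' j := if (j <= i)%N then h j else c.
have := rw_step rwW i h'.
have -> : [set w | forall j, (j <= i.+1)%N -> W j w = h' j] =
    C `&` [set w | W i.+1 w = c].
  apply/seteqP; split => w /= => [Wh|[Ch Wc] j].
    split=> [j ji|]; last by rewrite Wh // /h' ltnn.
    by rewrite Wh ?(leqW ji) // /h' ji.
  rewrite leq_eqVlt => /predU1P[->|]; first by rewrite /h' ltnn.
  by rewrite ltnS => ji; rewrite /h' ji Ch.
have -> : [set w | forall j, (j <= i)%N -> W j w = h' j] = C.
  by apply/seteqP; split => w /= Wh j ji; have := Wh j ji; rewrite /h' ji.
rewrite /h' leqnn ltnn /complete_graph hic.
have -> : #|[set v | h i != v]%SET| = n.+1.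
  have -> : [set v | h i != v]%SET = [set~ h i]%SET.
    by apply/setP => v; rewrite !inE eq_sym.
  by rewrite cardsC1 card_ord.
have DI : P C = (P (C `&` [set w | W i.+1 w != c]) + P (C `&` [set w | W i.+1 w = c]))%E.
  rewrite (measureDI P mC mc); congr (P _ + _)%E.
  by apply/seteqP; split=> w /= [Cw Wc]; split=> //; apply/eqP.
have mc' : measurable [set w | W i.+1 w != c].
  have -> : [set w | W i.+1 w != c] = ~` [set w | W i.+1 w = c].
    by apply/seteqP; split=> w /= /eqP.
  exact: measurableC.
have fin A : measurable A -> P A = (fine (P A))%:E.
  by move=> mA; rewrite fineK // fin_num_measure.
move: DI; rewrite (fin C) //.
rewrite (fin (C `&` [set w | W i.+1 w = c])); last exact: measurableI.
rewrite (fin (C `&` [set w | W i.+1 w != c])); last exact: measurableI.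
rewrite -!EFinM -EFinD => -[e1] -[e2]; congr EFin.
by rewrite /ratio mulrBl mul1r {1}e1 e2 mulrC addrK.
Qed.

(** Each step after time [s] contributes a factor [ratio]; time [s] itself is bounded trivially by
    1, hence the exponent [m] for [m.+1] times. *)
Lemma avoid_le (c : 'I_n.+2) s m :
  (P [set w | forall j, (j <= m)%N -> W (s + j)%N w != c] <= (ratio ^+ m)%:E)%E.
Proof.
have ratio0 : 0 <= ratio by rewrite subr_ge0 invf_le1 ?ltr0n // ler1n.
elim: m => [|m IH]; first by rewrite expr0 probability_le1 //; exact: measurable_avoid.
rewrite exprS EFinM; apply: le_trans (lee_wpmul2l _ IH); last by rewrite lee_fin.
set B := [set w | forall j, (j <= m)%N -> _].
have -> : [set w | forall j, (j <= m.+1)%N -> W (s + j)%N w != c] =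
    B `&` [set w | W (s + m).+1 w != c].
  apply/seteqP; split => w /= => [Wc|[Bw Wc] j].
    by split=> [j /leqW|]; [exact: Wc|rewrite -addnS Wc].
  by rewrite leq_eqVlt => /predU1P[->|]; [rewrite addnS|exact: Bw].
have mB : measurable B by exact: measurable_avoid.
have mc' : measurable [set w | W (s + m).+1 w != c].
  have -> : [set w | W (s + m).+1 w != c] = ~` [set w | W (s + m).+1 w = c].
    by apply/seteqP; split=> w /= /eqP.
  by apply: measurableC; case: rwW.
(* Conditioning on the trajectory up to time [s + m]: each fiber of [X] lies inside [B] or is
   disjoint from it. *)
pose X w := [ffun j : 'I_(s + m).+1 => W j w].
have XE h : [set w | X w = h] =
    [set w | forall j, (j <= s + m)%N -> W j w = h (inord j)].
  apply/seteqP; split => w /= => [<- j js|Wh].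
    by rewrite ffunE inordK.
  by apply/ffunP => j; rewrite ffunE Wh ?inord_val // -ltnS.
rewrite (probability_scale_fibers (X := X) (B := B) (a := ratio)) //.
- exact: measurableI.
- by move=> h; rewrite XE; exact: measurable_cylinder.
move=> h; have Xh w j : X w = h -> (j <= m)%N -> W (s + j)%N w = h (inord (s + j)).
  by move=> <- jm; rewrite ffunE inordK // ltnS leq_add2l.
have [hc|nhc] := pselect (forall j, (j <= m)%N -> h (inord (s + j)) != c).
  have BX : B `&` [set w | X w = h] = [set w | X w = h].
    apply/seteqP; split=> [w []|w Xw] //; split=> // j jm.
    by rewrite (Xh w) //; exact: hc.
  rewrite setIAC BX XE; apply: (@cylinder_step_avoid (fun j => h (inord j))).
  exact: hc.
have B0 : B `&` [set w | X w = h] = set0.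
  apply/seteqP; split=> // w [Bw Xw]; apply: nhc => j jm.
  by rewrite -(Xh w) //; exact: Bw.
by rewrite setIAC B0 set0I !measure0 mule0.
Qed.
End walk.

(** Union bound: missing window [k.+1] has probability at most [q ^+ (L + k)], and these sum to less
    than the probability of [W 0 = c 0]. *)
Lemma random_walk_hits (R : realType) (n : nat) : exists t : nat -> nat,
  [/\ t 0%N = 0%N, t 1%N = 1%N
    & forall (c : nat -> 'I_n.+2) (d : measure_display)
        (Omega : measurableType d) (P : probability Omega R)
        (W : nat -> Omega -> 'I_n.+2),
      random_walk (@complete_graph n.+2) P W ->
      exists A : set Omega, [/\ measurable A,
        A `<=` [set w | forall k, exists i, (t k <= i < t k.+1)%N /\ W i w = c k]
        & (0 < P A)%E]].
Proof.
pose q : R := 1 - n.+1%:R^-1.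
have q0 : 0 <= q by rewrite subr_ge0 invf_le1 ?ltr0n // ler1n.
have q1 : `|q| < 1 by rewrite ger0_norm // ltrBlDr ltrDl invr_gt0 ltr0n.
(* [L] is such that [q ^+ L / (1 - q)], that is [q ^+ L * n.+1%:R], is below [n.+2%:R^-1]. *)
have eps0 : 0 < n.+2%:R^-1 / n.+1%:R :> R by rewrite divr_gt0 ?invr_gt0 ?ltr0n.
have /cvgr0_norm_lt/(_ _ eps0)[L _ /(_ L (leqnn L)) /= Lq] := cvg_expr q1.
pose t := fix t k := if k is k'.+1 then
  if k' is k''.+1 then (t k' + (L + k'').+1)%N else 1%N else 0%N.
exists t; split=> // c d Omega P W rwW.
pose E k := [set w | forall j, (j <= L + k)%N -> W (t k.+1 + j)%N w != c k.+1].
have mE k : measurable (E k) by exact: measurable_avoid rwW _ _ _.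
have mU : measurable (\bigcup_k E k) by exact: bigcup_measurable.
have m0 : measurable [set w | W 0%N w = c 0%N] by case: rwW.
exists ([set w | W 0%N w = c 0%N] `\` \bigcup_k E k); split.
- exact: measurableD.
- move=> w [W0 notE] [|k]; first by exists 0%N.
  have /existsNP[j /not_implyP[jL /negP/negPn/eqP Wj]] : ~ E k w.
    by move=> Ekw; apply: notE; exists k.
  have tS : t k.+2 = (t k.+1 + (L + k).+1)%N by [].
  by exists (t k.+1 + j)%N; rewrite tS leq_addr ltn_add2l.
have PU : (P (\bigcup_k E k) < (n.+2%:R^-1)%:E)%E.
  have le_lim : (P (\bigcup_k E k) <= (q ^+ L * n.+1%:R)%:E)%E.
    have := measure_sigma_subadditive P mE mU (@subset_refl _ _).
    move/le_trans; apply.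
    apply: lime_le; first by apply: is_cvg_nneseries => k _ _; exact: measure_ge0.
    apply: nearW => N.
    apply: (@le_trans _ _ (\sum_(0 <= k < N) (q ^+ (L + k))%:E)%E).
      by apply: lee_sum => k _; exact: avoid_le.
    rewrite sumEFin lee_fin.
    have -> : \sum_(0 <= k < N) q ^+ (L + k) = series (geometric (q ^+ L) q) N.
      by apply: eq_bigr => k _ /=; rewrite exprD.
    rewrite geometric_seriesE ?lt_eqF ?(ltr_normlW q1) //= -mulrA.
    rewrite ler_wpM2l ?exprn_ge0 // /q subKr invrK ler_piMl // lerBlDr lerDl.
    exact: exprn_ge0.
  apply: le_lt_trans le_lim _; rewrite lte_fin -ltr_pdivlMr ?ltr0n //.
  by rewrite (le_lt_trans (ler_norm _)).
rewrite ltNge; apply/negP => PA0.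
have : (P [set w | W 0%N w = c 0%N] <= P (\bigcup_k E k))%E.
  rewrite (measureDI P m0 mU) -[leRHS]add0e; apply: leeD => //.
  by apply: le_measure; rewrite ?inE //; exact: measurableI.
by rewrite (rw_start rwW) card_ord leNgt PU.
Qed.

(** * Uncountability and upper density *)

(** Cantor's diagonal argument: [D] contradicts itself at its own code [h (S D)]. *)
Lemma uncountable_of_injective (T : Type) (A : set T) (S : (nat -> bool) -> T) :
  injective S -> (forall f, A (S f)) -> ~ countable A.
Proof.
move=> Sinj SA /countable_injP[h hinj].
have hS f g : h (S f) = h (S g) -> f = g.
  by move=> e; apply/Sinj/hinj; rewrite ?inE.
pose D k := `[< exists2 f, h (S f) = k & ~~ f k >].
have [Dk|nDk] := boolP (D (h (S D))).
  by have /asboolP[f /hS ->] := Dk; rewrite Dk.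
by move/asboolP: (nDk); apply; exists D.
Qed.

Lemma upper_density_ge (R : realType) (X : set nat) (a : R) :
  (forall N, exists2 m, (N <= m)%N &
     a <= (\sum_(1 <= i < m.+1) (i \in X)%:R) / m%:R) ->
  (a%:E <= upper_density R X)%E.
Proof.
move=> aX; rewrite /upper_density /limn_esup limf_esupE.
apply: le_ereal_inf_tmp => _ [B [N _ NB] <-]; apply: le_ereal_sup_tmp.
have [m Nm am] := aX N.
exists ((\sum_(1 <= i < m.+1) (i \in X)%:R) / m%:R)%:E; last by rewrite lee_fin.
by exists m => //; exact: NB.
Qed.

Lemma visit_timesS (V : finType) (S : nat -> V) v i :
  (i.+1 \in visit_times S v) = (S i == v).
Proof.
apply/idP/eqP => [|Si]; last by rewrite inE; exists i.
by rewrite inE => -[j /= Sj [<-]].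
Qed.

Lemma sum_even M : (\sum_(0 <= j < 2 * M) ~~ odd j = M)%N.
Proof.
elim: M => [|M IH]; first by rewrite big_nil.
by rewrite mulnS add2n !big_nat_recr //= IH mul2n odd_double addn1 addn0.
Qed.

(** The even offsets give [M] visits among the first [s + 2 * M] letters, a share of at least
    [1 / n.+2]. *)
Lemma alternation_density (R : realType) n (S : nat -> 'I_n.+2) v :
    (forall N, exists s M, [/\ (N <= M)%N, (s + 2 * M <= n.+2 * M)%N
      & forall j, (j < 2 * M)%N -> ~~ odd j -> S (s + j)%N = v]) ->
  ((n.+2%:R^-1 : R)%:E <= upper_density R (visit_times S v))%E.
Proof.
move=> Sv; apply: upper_density_ge => N; have [s [M [NM sM Sj]]] := Sv N.+1.
exists (s + 2 * M)%N; first by lia.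
have m0 : (0 < s + 2 * M)%N by lia.
rewrite ler_pdivlMr ?ltr0n // mulrC ler_pdivrMr ?ltr0n //.
rewrite big_add1 /= -natr_sum -natrM ler_nat.
apply: leq_trans sM _; rewrite mulnC leq_mul2r /=.
under eq_bigr do rewrite visit_timesS.
rewrite (big_cat_nat (n := s)) ?leq_addr //= -{1}(sum_even M).
apply: leq_trans (leq_addl _ _).
have -> : (\sum_(s <= i < s + 2 * M) (S i == v) =
           \sum_(0 <= j < 2 * M) (S (j + s) == v))%N.
  by rewrite -{1}[s]add0n big_addn addKn.
rewrite big_nat [leqRHS]big_nat; apply: leq_sum => j /andP[_ jM].
by case: (boolP (odd j)) => //= oj; rewrite addnC Sj // eqxx.
Qed.

(** * The family of walks indexed by binary sequences *)

Theorem theorem2p10 (R : realType) (n : nat) (hn : (5 <= n)%N) :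
  ~ countable [set S : nat -> 'I_n |
      [/\ is_walk (@complete_graph n) S,
          evasive R (@complete_graph n) S
        & forall v : 'I_n,
            ((n%:R^-1 : R)%:E <= upper_density R (visit_times S v))%E]].
Proof.
have -> : n = (n - 5).+4.+1 by lia.
move: (n - 5)%N => {hn} n'; clear n; rename n' into n.
have [t [t0 t1 tP]] := random_walk_hits R n.+3.
have [p [L [p0 pS Lpre LP]]] := lazy_sequence n (fun k => t k.+2 - t k)%N.
have p_inc k : (p k < p k.+1)%N by have := pS k; lia.
have p_ge k : (k <= p k)%N by elim: k => // k; have := p_inc k; lia.
have L0 f k : L f (p k) = inZp (k + 0).
  by have [_ La _] := LP f; have := La k 0%N isT; rewrite addn0.
have L1 f k : L f (p k).+1 = inZp (k + (f k).+1).
  by have [_ La _] := LP f; have := La k 1%N; rewrite addn1 => -> //; lia.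
have alt f k : L f (p k) != L f (p k).+1.
  rewrite L0 L1; apply/eqP => /inZp_window_inj.
  by case: (f k) => e; have := e isT isT.
have Lvar f N : exists2 s, (N <= s)%N & L f s != L f s.+1 by exists (p N).
have [S /all_and2[SL Swalk]] := choice (fun f => remove_repeats (Lvar f)).
apply: (@uncountable_of_injective _ _ S).
  (* The walk determines [f] by strong induction: if [f] and [g] agree below [k], their sequences
     have equally many changes up to [p k], and the next letter of the common walk reveals [f k]. *)
  move=> f g Sfg; apply/funext => k; have [m km] := ubnP k.
  elim: m k km => // m IH k; rewrite ltnS => km.
  have fg i : (i < k)%N -> f i = g i by move=> ik; apply: IH; exact: leq_trans km.
  have Lfg j : (j <= p k)%N -> L f j = L g j by exact: Lpre.
  have e : changes (L f) (p k) = changes (L g) (p k).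
    by apply: eq_bigr => s _; rewrite !Lfg // ltnW.
  have : L f (p k).+1 = L g (p k).+1.
    by rewrite -!SL !changesS !alt e Sfg.
  rewrite !L1 => /inZp_window_inj.
  by case: (f k); case: (g k) => // h; have := h isT isT.
move=> f; have [LA La Lu] := LP f; split=> [|d Omega P W rwW|v].
- exact: Swalk.
- have [A [mA AW PA]] := tP (fun k => inZp (k + 3)) d Omega P W rwW.
  exists A; split=> // w /AW hit.
  have [G [G0 Gmono Gunb GL]] :=
    hitting_staircase p0 p_inc LA Lu t0 t1 (fun k => leqnn _) hit.
  exact: staircase_remove_repeats (SL f) (Lvar f) G0 Gmono Gunb GL.
apply: alternation_density => N.
(* [k] is at least [N] and congruent to [v], so the even offsets at the start of block [k] carry
   [v]. *)
pose k := (v + N * n.+4.+1)%N.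
exists (changes (L f) (p k)), (p k).+1.
(* The alternating part has no repetitions, so it survives the deletion intact. *)
have cj j : (j < 2 * (p k).+1)%N ->
    changes (L f) (p k + j) = (changes (L f) (p k) + j)%N.
  elim: j => [|j IH] jM; first by rewrite !addn0.
  rewrite !addnS changesS IH ?(ltnW jM) // -addnS !La ?(ltnW jM) //=.
  suff -> : inZp (k + if odd j then (f k).+1 else 0) !=
    inZp (k + if ~~ odd j then (f k).+1 else 0) :> 'I_n.+4.+1 by rewrite addn1.
  by apply/eqP => /inZp_window_inj; case: odd; case: (f k) => e; have := e isT isT.
split.
- have : (N <= k)%N by rewrite /k; lia.
  by have := p_ge k; lia.
(* At most [p k] letters precede, so three times [(p k).+1] already suffices. *)
- by have := changes_leq (L f) (p k); lia.
move=> j jM /negPf ej; rewrite -cj // SL La // ej addn0.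
by apply: val_inj; rewrite /= /k addnC modnMDl modn_small.
Qed.
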